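(* Let $(P_1,P_2;Z)$ be an irreducible flat exact semisimple bihamiltonian structure of hydrodynamic type, let $\{h_{\alpha,p}\}$ be the calibration constructed from the functions $\theta_{\alpha,p}$ of its canonical Frobenius manifold structure, with generating functions $h_\alpha(v;z)=\sum_{p\ge-1}h_{\alpha,p}(v)z^{p+1}$, and define functions $\Omega_{\alpha,p;\beta,q}(v)$ by $$\frac{\partial h_\alpha(v;z_1)}{\partial v^\xi}\eta^{\xi\zeta}\frac{\partial h_\beta(v;z_2)}{\partial v^\zeta}-\eta_{\alpha\beta}=(z_1+z_2)\sum_{p,q\ge0}\Omega_{\alpha,p;\beta,q}(v)z_1^pz_2^q.$$ Then the collection $\{\Omega_{\alpha,p;\beta,q}(v)\mid\alpha,\beta=1,\dots,n;\ p,q\ge0\}$ is a tau structure of $(P_1,P_2;Z)$ with the given calibration $\{h_{\alpha,p}\}$.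
   Context: Everything is local on a small contractible domain $D$. A Hamiltonian structure of hydrodynamic type is an operator $g^{ij}(u)\partial_x+\Gamma^{ij}_k(u)u^k_x$ defining a Poisson bracket, with $\det(g^{ij})\neq0$; then $g$ is a flat contravariant metric and $\Gamma^{ij}_k$ its contravariant Levi-Civita coefficients. A bihamiltonian structure of hydrodynamic type is a pair $(P_1,P_2)$ all of whose linear combinations are again Poisson; $g_1,g_2$ denote the metrics. It is semisimple if the roots $u^1,\dots,u^n$ of $\det(g_2-ug_1)=0$ are pairwise distinct and non-constant; in these (canonical) coordinates $g_1^{ij}=f^i\delta^{ij}$, $g_2^{ij}=u^if^i\delta^{ij}$; put $f_i=1/f^i$ and $\gamma_{ij}=\frac1{2\sqrt{f_if_j}}\frac{\partial f_i}{\partial u^j}$ $(i\ne j)$. Irreducible: at no point $u\in D$ is there a partition of $\{1,\dots,n\}$ into nonempty $I,J$ with $\gamma_{ij}(u)=0$ for $i\in I$, $j\in J$. Flat exact: for $Z=\sum_i\partial/\partial u^i$ one has $\mathrm{Lie}$-type (Schouten) brackets $[Z,P_1]=0$, $[Z,P_2]=P_1$, and $Z$ is parallel for the Levi-Civita connection of $g_1$. $v^1,\dots,v^n$ are flat coordinates of $g_1$ with constant Gram matrix $\eta^{\alpha\beta}=g_1(dv^\alpha,dv^\beta)$, inverse $\eta_{\alpha\beta}$, chosen such that $Z=\partial/\partial v^1$; $v_\alpha=\eta_{\alpha\beta}v^\beta$; $P_1=\eta^{\alpha\beta}\partial_x$. Put $\partial=\partial_x$; $\mathcal A_0=C^\infty(D)$.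 Canonical Frobenius manifold structure (no quasi-homogeneity required): $c_{\alpha\beta\gamma}=\sum_if_i\frac{\partial u^i}{\partial v^\alpha}\frac{\partial u^i}{\partial v^\beta}\frac{\partial u^i}{\partial v^\gamma}=\frac{\partial^3F}{\partial v^\alpha\partial v^\beta\partial v^\gamma}$, with $F$ normalized by quadratic terms so that $\frac{\partial^2F}{\partial v^1\partial v^\alpha}=v_\alpha$. The functions $\theta_{\alpha,p}$, $p\ge0$: $\theta_{\alpha,0}=v_\alpha$, $\theta_{\alpha,1}=\partial F/\partial v^\alpha$, $\frac{\partial^2\theta_{\gamma,p+1}}{\partial v^\alpha\partial v^\beta}=c_{\alpha\beta\xi}\eta^{\xi\zeta}\frac{\partial\theta_{\gamma,p}}{\partial v^\zeta}$, and with $\theta_\alpha(v;z)=\sum_{p\ge0}\theta_{\alpha,p}z^p$ the normalization $\frac{\partial\theta_\alpha(v;z)}{\partial v^\xi}\eta^{\xi\zeta}\frac{\partial\theta_\beta(v;-z)}{\partial v^\zeta}=\eta_{\alpha\beta}$. Then $h_\alpha(v;z)=\frac1z\frac{\partial\theta_\alpha(v;z)}{\partial v^1}-\frac1z\eta_{\alpha1}$, i.e. $h_{\alpha,p}=\partial\theta_{\alpha,p+2}/\partial v^1$ for $p\ge-1$ (and linear terms of $F$ are adjusted so that $h_{\alpha,0}=\partial F/\partial v^\alpha$). The principal hierarchy is $\frac{\partial v^\gamma}{\partial t^{\alpha,p}}=\eta^{\gamma\lambda}\partial\frac{\partial h_{\alpha,p}}{\partial v^\lambda}$, $p\ge0$.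 Tau structure of $(P_1,P_2;Z)$ with calibration $\{h_{\alpha,p}\}$: a collection $\Omega_{\alpha,p;\beta,q}\in\mathcal A_0$ ($1\le\alpha,\beta\le n$; $p,q\ge0$) such that (i) $\partial\Omega_{\alpha,p;\beta,q}=\frac{\partial h_{\alpha,p-1}}{\partial t^{\beta,q}}=\frac{\partial h_{\beta,q-1}}{\partial t^{\alpha,p}}$; (ii) $\Omega_{\alpha,p;\beta,q}=\Omega_{\beta,q;\alpha,p}$; (iii) $\Omega_{\alpha,p;1,0}=h_{\alpha,p-1}$. *)

(* Defs.v *)
From HB Require Import structures.
From mathcomp Require Import all_boot all_order all_algebra.
From mathcomp Require Import all_classical all_reals all_analysis.
From mathcomp.real_closed Require Import complex.

Set Implicit Arguments.
Unset Strict Implicit.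
Unset Printing Implicit Defensive.
Import Order.TTheory GRing.Theory Num.Theory.
Import numFieldNormedType.Exports.

Local Open Scope classical_set_scope.
Local Open Scope ring_scope.

(** Points of the domain are row vectors of coordinates [w^k] in an arbitrary
    fixed chart; the canonical coordinates [u^i] and the flat coordinates
    [v^alpha] are families of functions of [w].  All indices start at [0], so
    the distinguished index "1" of [v^1] and [t^{1,0}] is [ord0]. *)

Section Calculus.
Variables (R : realType) (n : nat).
Implicit Types (D : set 'rV[R]_n.+1) (f : 'rV[R]_n.+1 -> R).
Implicit Types (w : 'rV[R]_n.+1) (x : 'I_n.+1 -> 'rV[R]_n.+1 -> R).

Definition partial (k : 'I_n.+1) f : 'rV[R]_n.+1 -> R :=
  fun w => 'D_(delta_mx 0 k) f w.

Definition smooth_on D f : Prop :=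
  forall (s : seq 'I_n.+1) w, D w -> differentiable (foldr partial f s) w.

Definition contractible D : Prop :=
  exists (w0 : 'rV[R]_n.+1) (H : R * 'rV[R]_n.+1 -> 'rV[R]_n.+1),
    [/\ {within [set tw : R * 'rV[R]_n.+1 | 0 <= tw.1 <= 1 /\ D tw.2],
          continuous H},
        forall t w, 0 <= t <= 1 -> D w -> D (H (t, w)),
        forall w, D w -> H (0, w) = w
      & forall w, D w -> H (1, w) = w0].

Definition domain D : Prop := [/\ open D, D !=set0 & contractible D].

(** [jacobian x w i k] is [dx^i/dw^k]. *)
Definition jacobian x w : 'M[R]_n.+1 := \matrix_(i, k) partial k (x i) w.

Definition coordinates D x : Prop :=
  [/\ forall i, smooth_on D (x i),
      forall w w', D w -> D w' -> (forall i, x i w = x i w') -> w = w'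
    & forall w, D w -> jacobian x w \in unitmx].

(** The components [dw^k/dx^i] of the coordinate vector field [d/dx^i]. *)
Definition coord_vec x (i : 'I_n.+1) w : 'rV[R]_n.+1 :=
  \row_k invmx (jacobian x w) k i.

(** The partial derivative [df/dx^i]. *)
Definition dcoord x (i : 'I_n.+1) f : 'rV[R]_n.+1 -> R :=
  fun w => \sum_k coord_vec x i w 0 k * partial k f w.

End Calculus.

Section Hydrodynamic.
Variables (R : realType) (n : nat).
Implicit Types (D : set 'rV[R]_n.+1) (w : 'rV[R]_n.+1).
Implicit Types (c xi eta zeta : R -> 'rV[R]_n.+1).

(** The operator [g^{ij}(w) d_x + Gamma^{ij}_k(w) w^k_x]. *)
Record hydro_op := HydroOp {
  hmet : 'rV[R]_n.+1 -> 'M[R]_n.+1;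
  hgam : 'I_n.+1 -> 'I_n.+1 -> 'I_n.+1 -> 'rV[R]_n.+1 -> R
}.

Definition hydro_comb (a b : R) (P Q : hydro_op) : hydro_op :=
  HydroOp (fun w => a *: hmet P w + b *: hmet Q w)
          (fun i j k w => a * hgam P i j k w + b * hgam Q i j k w).

Definition smooth_op D (P : hydro_op) : Prop :=
  (forall i j, smooth_on D (fun w => hmet P w i j)) /\
  (forall i j k, smooth_on D (hgam P i j k)).

Definition smooth_loop c : Prop :=
  (forall i m t, derivable (derive1n m (fun s => c s 0 i)) t 1) /\
  (forall t, c (t + 1) = c t).

Definition loop_in D c : Prop := smooth_loop c /\ forall t, D (c t).

Definition velocity c : R -> 'rV[R]_n.+1 :=
  fun t => \row_k derive1 (fun s => c s 0 k) t.

(** The vector [P^{ij} xi_j] at the loop [c]: the Hamiltonian vector field of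
    the linear functional [\int xi_i w^i dx]. *)
Definition hydro_app (P : hydro_op) c xi : R -> 'rV[R]_n.+1 :=
  fun t => \row_i \sum_j
    (hmet P (c t) i j * velocity xi t 0 j
     + (\sum_k hgam P i j k (c t) * velocity c t 0 k) * xi t 0 j).

(** Bivectors on the loop space are identified with their values
    [B c xi eta] at a loop [c] on [c]-independent covectors [xi], [eta].  For
    a hydrodynamic operator this value is the bracket of the linear
    functionals [\int xi_i w^i dx] and [\int eta_j w^j dx], i.e. the smeared
    form of
    [{w^i(x), w^j(y)} = g^{ij}(w(x)) delta'(x-y)
                        + Gamma^{ij}_k(w(x)) w^k_x delta(x-y)]. *)
Definition bivector := (R -> 'rV[R]_n.+1) -> (R -> 'rV[R]_n.+1) ->
  (R -> 'rV[R]_n.+1) -> R.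

Definition hydro_bracket (P : hydro_op) : bivector := fun c xi eta =>
  \int[@lebesgue_measure R]_(t in `[0, 1])
    (\sum_i xi t 0 i * hydro_app P c eta t 0 i).

(** Derivative of [B . xi eta] at the loop [c] along the vector [X]. *)
Definition loop_deriv (B : bivector) c (X : R -> 'rV[R]_n.+1) xi eta : R :=
  derive1 (fun e : R => B (fun t => c t + e *: X t) xi eta) 0.

Definition poisson D (P : hydro_op) : Prop :=
  let B := hydro_bracket P in
  (forall c xi eta, loop_in D c -> smooth_loop xi -> smooth_loop eta ->
     B c xi eta = - B c eta xi) /\
  (forall c xi eta zeta, loop_in D c ->
     smooth_loop xi -> smooth_loop eta -> smooth_loop zeta ->
     loop_deriv B c (hydro_app P c zeta) xi eta
     + loop_deriv B c (hydro_app P c xi) eta zeta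
     + loop_deriv B c (hydro_app P c eta) zeta xi = 0).

Definition hamiltonian_hydro D (P : hydro_op) : Prop :=
  [/\ smooth_op D P, forall w, D w -> \det (hmet P w) != 0 & poisson D P].

Definition bihamiltonian_hydro D (P1 P2 : hydro_op) : Prop :=
  [/\ hamiltonian_hydro D P1, hamiltonian_hydro D P2
    & forall a b, poisson D (hydro_comb a b P1 P2)].

(** The bracket [[Z, B]] of a vector field [Z] on [D] with a bivector [B],
    i.e. the Lie derivative
    [Z(B(xi, eta)) - B(L_Z xi, eta) - B(xi, L_Z eta)], where
    [(L_Z xi)_k = xi_l dZ^l/dw^k] since [xi] does not depend on the loop. *)
Definition lie_covector (Z : 'rV[R]_n.+1 -> 'rV[R]_n.+1) c xi :
    R -> 'rV[R]_n.+1 :=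
  fun t => \row_k \sum_l xi t 0 l * partial k (fun w => Z w 0 l) (c t).

Definition schouten (Z : 'rV[R]_n.+1 -> 'rV[R]_n.+1) (B : bivector) :
    bivector :=
  fun c xi eta => loop_deriv B c (Z \o c) xi eta
    - B c (lie_covector Z c xi) eta - B c xi (lie_covector Z c eta).

Definition bivector_eq D (A B : bivector) : Prop :=
  forall c xi eta, loop_in D c -> smooth_loop xi -> smooth_loop eta ->
    A c xi eta = B c xi eta.

(** Christoffel symbols [Gamma^j_{kl}] of the metric whose contravariant
    components are [g]. *)
Definition christoffel (g : 'rV[R]_n.+1 -> 'M[R]_n.+1) (j k l : 'I_n.+1) w : R :=
  let gl (a b : 'I_n.+1) := fun w' => invmx (g w') a b in
  2^-1 * \sum_m g w j m *
    (partial k (gl m l) w + partial l (gl m k) w - partial m (gl k l) w).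

Definition parallel D (g : 'rV[R]_n.+1 -> 'M[R]_n.+1)
    (Z : 'rV[R]_n.+1 -> 'rV[R]_n.+1) : Prop :=
  forall w, D w -> forall j k,
    partial k (fun w' => Z w' 0 j) w + \sum_l christoffel g j k l w * Z w 0 l = 0.

(** Components [g(dx^i, dx^j)] of a contravariant metric. *)
Definition gram (g : 'rV[R]_n.+1 -> 'M[R]_n.+1)
    (x : 'I_n.+1 -> 'rV[R]_n.+1 -> R) w : 'M[R]_n.+1 :=
  jacobian x w *m g w *m (jacobian x w)^T.

End Hydrodynamic.

Section Semisimple.
Variables (R : realType) (n : nat) (D : set 'rV[R]_n.+1).
Variables (P1 P2 : hydro_op R n) (u : 'I_n.+1 -> 'rV[R]_n.+1 -> R).
Implicit Types (w : 'rV[R]_n.+1) (i j : 'I_n.+1).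

Definition f_up i w : R := gram (hmet P1) u w i i.
Definition f_low i w : R := (f_up i w)^-1.

Definition semisimple : Prop :=
  [/\ forall w, D w -> forall lambda : R,
        \det (hmet P2 w - lambda *: hmet P1 w) = 0 <->
        exists i, lambda = u i w,
      forall w, D w -> forall i j, i != j -> u i w != u j w
    & forall i, exists w w', [/\ D w, D w' & u i w != u i w']].

Definition canonical_coordinates : Prop :=
  [/\ coordinates D u,
      forall w, D w -> forall i j,
        gram (hmet P1) u w i j = f_up i w *+ (i == j)
    & forall w, D w -> forall i j,
        gram (hmet P2) u w i j = (u i w * f_up i w) *+ (i == j)].

(** The [f_i] may have different signs, hence the complex square root. *)
Definition rotation i j w : R[i] :=
  (dcoord u j (f_low i) w)%:C%C / (2 * sqrtC ((f_low i w * f_low j w)%:C%C)).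

Definition irreducible : Prop :=
  forall w, D w -> ~ exists I J : {set 'I_n.+1},
    [/\ I != finset.set0, J != finset.set0, I :|: J = [set: 'I_n.+1]%SET,
        I :&: J = finset.set0
      & forall i j, i \in I -> j \in J -> rotation i j w = 0].

(** [Z = \sum_i d/du^i]. *)
Definition Zfield w : 'rV[R]_n.+1 := \sum_i coord_vec u i w.

Definition flat_exact : Prop :=
  [/\ bivector_eq D (schouten Zfield (hydro_bracket P1)) (fun _ _ _ => 0),
      bivector_eq D (schouten Zfield (hydro_bracket P2)) (hydro_bracket P1)
    & parallel D (hmet P1) Zfield].

Definition irreducible_flat_exact_semisimple_bihamiltonian : Prop :=
  [/\ bihamiltonian_hydro D P1 P2, semisimple, canonical_coordinates,
      irreducible & flat_exact].

End Semisimple.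

Section Frobenius.
Variables (R : realType) (n : nat) (D : set 'rV[R]_n.+1).
Variables (P1 : hydro_op R n) (u v : 'I_n.+1 -> 'rV[R]_n.+1 -> R).
Variable eta : 'M[R]_n.+1.
Implicit Types (w : 'rV[R]_n.+1) (al be ga : 'I_n.+1).

(** [eta] is the Gram matrix with upper indices, [eta_low] its inverse. *)
Definition eta_low : 'M[R]_n.+1 := invmx eta.

Definition flat_coordinates : Prop :=
  [/\ coordinates D v, forall w, D w -> gram (hmet P1) v w = eta
    & forall w, D w -> Zfield u w = coord_vec v ord0 w].

Definition v_low al w : R := \sum_be eta_low al be * v be w.

Definition c_tensor al be ga w : R :=
  \sum_i f_low P1 u i w
    * dcoord v al (u i) w * dcoord v be (u i) w * dcoord v ga (u i) w.

Definition frobenius_potential (F : 'rV[R]_n.+1 -> R) : Prop :=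
  [/\ smooth_on D F,
      forall w, D w -> forall al be ga,
        dcoord v al (dcoord v be (dcoord v ga F)) w = c_tensor al be ga w
    & forall w, D w -> forall al,
        dcoord v ord0 (dcoord v al F) w = v_low al w].

(** [<grad f, grad g> = df/dv^xi eta^{xi zeta} dg/dv^zeta]. *)
Definition grad_pair (f g : 'rV[R]_n.+1 -> R) w : R :=
  \sum_xi \sum_zeta dcoord v xi f w * eta xi zeta * dcoord v zeta g w.

(** [theta al p] is [theta_{alpha,p}].  The last clause is the coefficient of
    [z^m] in [<grad theta_alpha(z), grad theta_beta(-z)> = eta_{alpha beta}]. *)
Definition frobenius_thetas (F : 'rV[R]_n.+1 -> R)
    (theta : 'I_n.+1 -> nat -> 'rV[R]_n.+1 -> R) : Prop :=
  (forall al p, smooth_on D (theta al p)) /\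
  forall w, D w ->
  [/\ forall al, theta al 0%N w = v_low al w,
      forall al, theta al 1%N w = dcoord v al F w,
      forall al be ga p,
        dcoord v al (dcoord v be (theta ga p.+1)) w =
        \sum_xi \sum_zeta
          c_tensor al be xi w * eta xi zeta * dcoord v zeta (theta ga p) w
    & forall al be m,
        \sum_(p < m.+1)
          (-1) ^+ (m - p) * grad_pair (theta al p) (theta be (m - p)%N) w =
        eta_low al be *+ (m == 0%N)].

(** Shifted index: [hcal theta al k] is [h_{alpha,k-1}], the coefficient of
    [z^k] in
    [h_alpha(v;z) = (d theta_alpha(v;z)/dv^1 - eta_{alpha 1}) / z]. *)
Definition hcal (theta : 'I_n.+1 -> nat -> 'rV[R]_n.+1 -> R)
    (al : 'I_n.+1) (k : nat) : 'rV[R]_n.+1 -> R :=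
  dcoord v ord0 (theta al k.+1).

End Frobenius.

Section Tau.
Variables (R : realType) (n : nat) (D : set 'rV[R]_n.+1).
Variables (v : 'I_n.+1 -> 'rV[R]_n.+1 -> R) (eta : 'M[R]_n.+1).
(** [h al k] is [h_{alpha,k-1}]. *)
Variable h : 'I_n.+1 -> nat -> 'rV[R]_n.+1 -> R.
Implicit Types (w wx : 'rV[R]_n.+1) (f : 'rV[R]_n.+1 -> R).
Implicit Types (al be ga : 'I_n.+1) (p q : nat).

(** Differential polynomials of degree one, i.e. linear in [w_x], are functions
    of the first jet [(w, wx)] with [wx = w_x].  [total_x f] is
    [d_x f = df/dw^k w^k_x]. *)
Definition total_x f w wx : R := \sum_k partial k f w * wx 0 k.

(** [dv^gamma/dt^{beta,q}
      = eta^{gamma lambda} d_x (dh_{beta,q}/dv^lambda)]. *)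
Definition principal_flow be q ga w wx : R :=
  \sum_la eta ga la * total_x (dcoord v la (h be q.+1)) w wx.

(** [df/dt^{beta,q}] for [f] a function of [w]. *)
Definition time_deriv be q f w wx : R :=
  \sum_ga dcoord v ga f w * principal_flow be q ga w wx.

Definition tau_structure
    (Omega : 'I_n.+1 -> nat -> 'I_n.+1 -> nat -> 'rV[R]_n.+1 -> R) : Prop :=
  [/\ forall al p be q, smooth_on D (Omega al p be q),
      forall al p be q w wx, D w ->
        total_x (Omega al p be q) w wx = time_deriv be q (h al p) w wx /\
        total_x (Omega al p be q) w wx = time_deriv al p (h be q) w wx,
      forall al p be q w, D w -> Omega al p be q w = Omega be q al p w
    & forall al p w, D w -> Omega al p ord0 0%N w = h al p w].

(** Formal power series in [z1], [z2]: [a p q] is the coefficient of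
    [z1^p z2^q]. *)
Definition fps2 := nat -> nat -> R.

Definition fps2_const (a : R) : fps2 :=
  fun p q => a *+ ((p == 0%N) && (q == 0%N)).

Definition fps2_z1Dz2 : fps2 := fun p q =>
  ((p == 1%N) && (q == 0%N))%:R + ((p == 0%N) && (q == 1%N))%:R.

Definition fps2_mul (a b : fps2) : fps2 := fun p q =>
  \sum_(i < p.+1) \sum_(j < q.+1) a i j * b (p - i)%N (q - j)%N.

Definition generating_identity
    (Omega : 'I_n.+1 -> nat -> 'I_n.+1 -> nat -> 'rV[R]_n.+1 -> R) : Prop :=
  forall w, D w -> forall al be p q,
    grad_pair v eta (h al p) (h be q) w - fps2_const (eta_low eta al be) p q =
    fps2_mul fps2_z1Dz2 (fun p' q' => Omega al p' be q' w) p q.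

End Tau.

(* Main.v *)
Require Import Defs.
From mathcomp Require Import all_boot all_order all_algebra.
From mathcomp Require Import all_classical all_reals all_analysis.

Set Implicit Arguments.
Unset Strict Implicit.
Unset Printing Implicit Defensive.
Import Order.TTheory GRing.Theory Num.Theory.
Import numFieldNormedType.Exports.

Local Open Scope classical_set_scope.
Local Open Scope ring_scope.

(** Write [G_{p,q}] for [<grad h_{alpha,p-1}, grad h_{beta,q-1}>].  The
    statement is an exercise in differentiating the pairing of two solutions of
    the deformed flatness equations
    [d_mu d_lambda theta_{p+1} = c_{mu lambda}^zeta d_zeta theta_p].

    Contracting these equations with the unit field [d/dv^1], for which
    [c_{1 lambda}^zeta] is the identity ([c_tensor_unit]), gives
    [grad h_{alpha,p-1} = grad theta_{alpha,p}] ([grad_h]).  Hence [G] is also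
    the pairing of the [theta]'s, and the normalization of [theta(z)] against
    [theta(-z)] says that [G - eta] vanishes on [z1 + z2 = 0].  A formal series
    with this property is divisible by [z1 + z2] ([fps2_quotP]); the quotient is
    always unique ([fps2_quot_uniq]) because comparing coefficients gives
    [Omega_{p,q+1} = G_{p+1,q+1} - Omega_{p+1,q}] and
    [Omega_{p,0} = G_{p+1,0}].  This settles existence and uniqueness.

    For the tau structure, let [T_mu(p,q)] be the contraction
    [d_gamma theta_{alpha,p} c_mu^{gamma zeta} d_zeta theta_{beta,q}].  It is
    symmetric in the two arguments since [c] is totally symmetric, and by the
    Leibniz rule [d_mu G_{p,q} = T_mu(p-1,q) + T_mu(p,q-1)]
    ([dcoord_grad_pair_theta]).  Thus [T_mu] satisfies the differentiated
    recursion of [Omega], so [d_mu Omega_{p,q} = T_mu(p,q)] ([dcoord_Omega]).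
    Multiplying by [v^mu_x] yields exactly the time derivative of
    [h_{alpha,p-1}] along [t^{beta,q}] ([time_derivE]), and the symmetry of
    [T_mu] yields the second equality in (i).  Symmetry of [Omega] follows from
    uniqueness, as exchanging the two variables preserves the defining identity;
    and [Omega_{alpha,p;1,0} = G_{p+1,0}] is the derivative of
    [theta_{alpha,p+1}] along the gradient of [v_1], that is along
    [d/dv^1] ([Omega_unit]).  Smoothness of [Omega] is inherited from [theta]
    through the recursion. *)

(** * Differentiability and partial derivatives on an open set *)

Section NearDifferentiable.
Variables (R : numFieldType) (V W : normedModType R).

(** Differentiability only depends on the germ: the first-order expansion of
    [f] at [x] is also one of [g]. *)
Lemma near_eq_differentiable (f g : V -> W) (x : V) :
  (\near x, f x = g x) -> differentiable f x -> differentiable g x.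
Proof.
move=> fg df; have fgx : f x = g x := nbhs_singleton fg.
have [cdf ef] := (diff_locallyP x f).1 df.
have eg : g \o shift x = cst (g x) + 'd f x +o_ 0 id.
  apply/eqaddoP => e e0; move/eqaddoP: ef => /(_ e e0) ef.
  have fg0 : \forall h \near 0, f (h + x) = g (h + x).
    by move: fg; rewrite (near_shift 0) subr0.
  by apply: filterS2 fg0 ef => h; rewrite !fctE /= fgx => ->.
by apply/diff_locallyP; rewrite (diff_unique cdf eg).
Qed.

End NearDifferentiable.

Section PartialDerivatives.
Variables (R : realType) (n : nat) (D : set 'rV[R]_n.+1).
Implicit Types (f g : 'rV[R]_n.+1 -> R) (w : 'rV[R]_n.+1) (k : 'I_n.+1).

Lemma partial_cst k (a : R) w : partial k (fun=> a) w = 0.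
Proof. exact: derive_cst. Qed.

Lemma partialD k f g w : differentiable f w -> differentiable g w ->
  partial k (fun w => f w + g w) w = partial k f w + partial k g w.
Proof. by move=> df dg; apply: deriveD; exact: diff_derivable. Qed.

Lemma partialM k f g w : differentiable f w -> differentiable g w ->
  partial k (fun w => f w * g w) w = partial k f w * g w + f w * partial k g w.
Proof.
move=> df dg; rewrite [LHS]deriveM; try exact: diff_derivable.
by rewrite addrC [g w *: _]mulrC.
Qed.

Lemma partialV k f w : f w != 0 -> differentiable f w ->
  partial k (fun w => (f w)^-1) w = - partial k f w * ((f w)^-1 * (f w)^-1).
Proof.
move=> f0 df; rewrite [LHS]deriveV //; last exact: diff_derivable.
by rewrite -invfM -expr2 [LHS]mulNr mulNr mulrC.
Qed.

Hypothesis openD : open D.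

Lemma eq_on_near f g w : (forall w, D w -> f w = g w) -> D w ->
  \near w, f w = g w.
Proof. by move=> fg Dw; near=> y; apply: fg; near: y; exact: open_nbhs_nbhs.
Unshelve. all: by end_near. Qed.

Lemma eq_on_differentiable f g w : (forall w, D w -> f w = g w) -> D w ->
  differentiable f w -> differentiable g w.
Proof. by move=> fg Dw; apply: near_eq_differentiable; exact: eq_on_near. Qed.

Lemma eq_on_partial k f g : (forall w, D w -> f w = g w) ->
  forall w, D w -> partial k f w = partial k g w.
Proof. by move=> fg w Dw; apply: near_eq_derive; exact: eq_on_near. Qed.

(** Finite-order smoothness: closure of [smooth_on] under products and
    inverses is proved by induction on the order, with Leibniz' rule
    expressing the derivative through functions of the next lower order. *)
Fixpoint smooth_upto m f : Prop :=
  (forall w, D w -> differentiable f w) /\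
  if m is m'.+1 then forall k, smooth_upto m' (partial k f) else True.

Lemma smooth_onP f : smooth_on D f <-> forall m, smooth_upto m f.
Proof.
split=> [sf m|sf s].
  elim: m f sf => [|m IH] f sf; split=> //; first exact: (sf [::]).
    exact: (sf [::]).
  move=> k; apply: IH => s w Dw.
  by have := sf (rcons s k) w Dw; rewrite foldr_rcons.
have {sf} := sf (size s); elim/last_ind: s f => [|s k IH] f /=; first by case.
by rewrite size_rcons foldr_rcons => -[_ /(_ k)]; exact: IH.
Qed.

Lemma smooth_uptoW m f : smooth_upto m.+1 f -> smooth_upto m f.
Proof.
elim: m f => [|m IH] f [df sf]; split=> // k.
exact: IH.
Qed.

Lemma eq_on_smooth_upto m f g : (forall w, D w -> f w = g w) ->
  smooth_upto m f -> smooth_upto m g.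
Proof.
elim: m f g => [|m IH] f g fg [df sf]; split=> //.
- by move=> w Dw; exact: eq_on_differentiable (df w Dw).
- by move=> w Dw; exact: eq_on_differentiable (df w Dw).
- by move=> k; apply: IH (sf k); exact: eq_on_partial.
Qed.

Lemma smooth_uptoD m f g : smooth_upto m f -> smooth_upto m g ->
  smooth_upto m (fun w => f w + g w).
Proof.
elim: m f g => [|m IH] f g sf sg; split.
- move=> w Dw; exact: (differentiableD (sf.1 w Dw) (sg.1 w Dw)).
- by [].
- move=> w Dw; exact: (differentiableD (sf.1 w Dw) (sg.1 w Dw)).
- move=> k; apply: eq_on_smooth_upto (IH _ _ (sf.2 k) (sg.2 k)) => w Dw.
  by rewrite partialD //; [exact: sf.1|exact: sg.1].
Qed.

Lemma smooth_uptoM m f g : smooth_upto m f -> smooth_upto m g ->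
  smooth_upto m (fun w => f w * g w).
Proof.
elim: m f g => [|m IH] f g sf sg; split.
- move=> w Dw; exact: (differentiableM (sf.1 w Dw) (sg.1 w Dw)).
- by [].
- move=> w Dw; exact: (differentiableM (sf.1 w Dw) (sg.1 w Dw)).
- move=> k; have := smooth_uptoD (IH _ _ (sf.2 k) (smooth_uptoW sg))
    (IH _ _ (smooth_uptoW sf) (sg.2 k)).
  apply: eq_on_smooth_upto => w Dw.
  by rewrite partialM //; [exact: sf.1|exact: sg.1].
Qed.

Lemma smooth_upto_cst m (a : R) : smooth_upto m (fun=> a).
Proof.
elim: m a => [|m IH] a; split=> //.
- by move=> k; apply: eq_on_smooth_upto (IH 0) => w Dw; rewrite partial_cst.
Qed.

(** The derivative [- f' (1/f)^2] involves [1/f] only at the order for which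
    smoothness is already known. *)
Lemma smooth_uptoV m f : (forall w, D w -> f w != 0) ->
  smooth_upto m f -> smooth_upto m (fun w => (f w)^-1).
Proof.
move=> f0; elim: m => [|m IH] sf; split=> //.
- by move=> w Dw; apply: differentiableV; [exact: sf.1|exact: f0].
- by move=> w Dw; apply: differentiableV; [exact: sf.1|exact: f0].
move=> k; have sV := IH (smooth_uptoW sf).
have := smooth_uptoM (smooth_uptoM (smooth_upto_cst m (-1)) (sf.2 k))
  (smooth_uptoM sV sV).
apply: eq_on_smooth_upto => w Dw.
by rewrite partialV ?f0 ?mulN1r//; exact: sf.1.
Qed.

Lemma smooth_on_differentiable f w :
  smooth_on D f -> D w -> differentiable f w.
Proof. exact: (fun sf => sf [::] w). Qed.

Lemma smooth_on_partial k f : smooth_on D f -> smooth_on D (partial k f).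
Proof. by move=> sf s w Dw; have := sf (rcons s k) w Dw; rewrite foldr_rcons. Qed.

Lemma eq_on_smooth f g : (forall w, D w -> f w = g w) ->
  smooth_on D f -> smooth_on D g.
Proof.
by move=> fg /smooth_onP sf; apply/smooth_onP => m; exact: eq_on_smooth_upto (sf m).
Qed.

Lemma smooth_cst (a : R) : smooth_on D (fun=> a).
Proof. by apply/smooth_onP => m; exact: smooth_upto_cst. Qed.

Lemma smoothD f g : smooth_on D f -> smooth_on D g ->
  smooth_on D (fun w => f w + g w).
Proof.
move=> /smooth_onP sf /smooth_onP sg; apply/smooth_onP => m.
exact: smooth_uptoD.
Qed.

Lemma smoothM f g : smooth_on D f -> smooth_on D g ->
  smooth_on D (fun w => f w * g w).
Proof.
move=> /smooth_onP sf /smooth_onP sg; apply/smooth_onP => m.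
exact: smooth_uptoM.
Qed.

Lemma smoothV f : (forall w, D w -> f w != 0) -> smooth_on D f ->
  smooth_on D (fun w => (f w)^-1).
Proof.
by move=> f0 /smooth_onP sf; apply/smooth_onP => m; exact: smooth_uptoV.
Qed.

Lemma smooth_sum (I : Type) (r : seq I) (F : I -> 'rV[R]_n.+1 -> R) :
  (forall i, smooth_on D (F i)) -> smooth_on D (fun w => \sum_(i <- r) F i w).
Proof.
move=> sF; elim: r => [|i r IH].
  by apply: eq_on_smooth (smooth_cst 0) => w _; rewrite big_nil.
by apply: eq_on_smooth (smoothD (sF i) IH) => w _; rewrite big_cons.
Qed.

Lemma smooth_prod (I : Type) (r : seq I) (F : I -> 'rV[R]_n.+1 -> R) :
  (forall i, smooth_on D (F i)) -> smooth_on D (fun w => \prod_(i <- r) F i w).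
Proof.
move=> sF; elim: r => [|i r IH].
  by apply: eq_on_smooth (smooth_cst 1) => w _; rewrite big_nil.
by apply: eq_on_smooth (smoothM (sF i) IH) => w _; rewrite big_cons.
Qed.

Lemma smooth_det m (A : 'rV[R]_n.+1 -> 'M[R]_m) :
  (forall i j, smooth_on D (fun w => A w i j)) ->
  smooth_on D (fun w => \det (A w)).
Proof.
move=> sA; apply: smooth_sum => s.
by apply: smoothM; [exact: smooth_cst|apply: smooth_prod => i; exact: sA].
Qed.

(** Cramer's rule: the entries are cofactors over the determinant. *)
Lemma smooth_invmx m (A : 'rV[R]_n.+1 -> 'M[R]_m) i j :
  (forall w, D w -> A w \in unitmx) ->
  (forall i j, smooth_on D (fun w => A w i j)) ->
  smooth_on D (fun w => invmx (A w) i j).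
Proof.
move=> uA sA.
have sC : smooth_on D (fun w => cofactor (A w) j i).
  apply: smoothM; first exact: smooth_cst.
  apply: smooth_det => a b.
  by apply: eq_on_smooth (sA (lift j a) (lift i b)) => w _; rewrite !mxE.
have sV : smooth_on D (fun w => (\det (A w))^-1).
  by apply: smoothV (smooth_det sA) => w /uA; rewrite unitmxE unitfE.
apply: eq_on_smooth (smoothM sV sC) => w Dw.
by rewrite /invmx uA // !mxE.
Qed.

End PartialDerivatives.

(** * Derivatives with respect to a coordinate system *)

Section CoordinateDerivatives.
Variables (R : realType) (n : nat) (D : set 'rV[R]_n.+1).
Variable v : 'I_n.+1 -> 'rV[R]_n.+1 -> R.
Hypotheses (openD : open D) (cv : coordinates D v).
Implicit Types (f g : 'rV[R]_n.+1 -> R) (w wx : 'rV[R]_n.+1) (al be : 'I_n.+1).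

Lemma eq_on_dcoord al f g : (forall w, D w -> f w = g w) ->
  forall w, D w -> dcoord v al f w = dcoord v al g w.
Proof.
by move=> fg w Dw; apply: eq_bigr => k _; rewrite (eq_on_partial openD k fg).
Qed.

Lemma dcoord_cst al (a : R) w : dcoord v al (fun=> a) w = 0.
Proof. by rewrite /dcoord big1 // => k _; rewrite partial_cst mulr0. Qed.

Lemma dcoordD al f g w : differentiable f w -> differentiable g w ->
  dcoord v al (fun w => f w + g w) w = dcoord v al f w + dcoord v al g w.
Proof.
move=> df dg; rewrite /dcoord -big_split; apply: eq_bigr => k _.
by rewrite partialD // mulrDr.
Qed.

Lemma dcoordM al f g w : differentiable f w -> differentiable g w ->
  dcoord v al (fun w => f w * g w) w =
  dcoord v al f w * g w + f w * dcoord v al g w.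
Proof.
move=> df dg; rewrite /dcoord mulr_suml mulr_sumr -big_split; apply: eq_bigr => k _.
by rewrite partialM // mulrDr mulrA [f w * (_ * _)]mulrCA.
Qed.

Lemma dcoordZ al (a : R) f w : differentiable f w ->
  dcoord v al (fun w => a * f w) w = a * dcoord v al f w.
Proof.
by move=> df; rewrite dcoordM ?dcoord_cst ?mul0r ?add0r.
Qed.

Lemma dcoord_sum al (I : Type) (r : seq I) (F : I -> 'rV[R]_n.+1 -> R) w :
  D w -> (forall i, smooth_on D (F i)) ->
  dcoord v al (fun w => \sum_(i <- r) F i w) w = \sum_(i <- r) dcoord v al (F i) w.
Proof.
move=> Dw sF; elim: r => [|i r IH].
  rewrite big_nil -[RHS](dcoord_cst al 0 w).
  by apply: eq_on_dcoord Dw => y _; rewrite big_nil.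
rewrite big_cons -IH -dcoordD.
- by apply: eq_on_dcoord Dw => y _; rewrite big_cons.
- exact: smooth_on_differentiable (sF i) Dw.
- exact: smooth_on_differentiable (smooth_sum openD r sF) Dw.
Qed.

(** The coefficients of the coordinate vector fields are entries of the inverse
    Jacobian, hence smooth. *)
Lemma smooth_dcoord al f : smooth_on D f -> smooth_on D (dcoord v al f).
Proof.
have [sv _ uv] := cv => sf; apply: (smooth_sum openD) => k.
apply: (smoothM openD); last exact: smooth_on_partial.
apply: eq_on_smooth openD _ _ _ (smooth_invmx openD k al uv _); last first.
  move=> i j; apply: eq_on_smooth openD _ _ _ (smooth_on_partial j (sv i)).
  by move=> w _; rewrite mxE.
by move=> w _; rewrite mxE.
Qed.

Lemma dcoord_coord al be w : D w -> dcoord v al (v be) w = (al == be)%:R.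
Proof.
have [_ _ uv] := cv => Dw.
transitivity ((Defs.jacobian v w *m invmx (Defs.jacobian v w)) be al).
  by rewrite mxE; apply: eq_bigr => k _; rewrite !mxE mulrC.
by rewrite mulmxV ?uv // mxE eq_sym.
Qed.

(** The chain rule, which reduces the total [x]-derivative in the given chart to
    derivatives in the coordinates [v]. *)
Lemma total_xE f w wx : D w ->
  total_x f w wx = \sum_al dcoord v al f w * total_x (v al) w wx.
Proof.
have [_ _ uv] := cv => Dw.
pose J := Defs.jacobian v w; pose df := \row_k partial k f w.
have -> : total_x f w wx = (df *m wx^T) 0 0.
  by rewrite mxE; apply: eq_bigr => k _; rewrite !mxE.
have -> : df *m wx^T = (df *m invmx J) *m (J *m wx^T).
  by rewrite mulmxA mulmxKV // uv.
rewrite mxE; apply: eq_bigr => al _; rewrite !mxE; congr (_ * _).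
  by apply: eq_bigr => k _; rewrite !mxE mulrC.
by apply: eq_bigr => k _; rewrite !mxE.
Qed.

End CoordinateDerivatives.

(** * Division of formal series by z1 + z2 *)

Section DivisionByZ1PlusZ2.
Variable R : realType.
Implicit Types a b : fps2 R.

Lemma fps2_mul_z1Dz2 b p q :
  fps2_mul (@fps2_z1Dz2 R) b p q =
  (if p is p'.+1 then b p' q else 0) + (if q is q'.+1 then b p q' else 0).
Proof.
have oneD (r j : nat) (F : nat -> R) :
    \sum_(i < r.+1) (i == j :> nat)%:R * F i = if (j <= r)%N then F j else 0.
  rewrite (eq_bigr (fun i : 'I_r.+1 =>
    if i == j :> nat then F i else 0)); last first.
    by move=> i _; case: eqP => _; rewrite (mul1r, mul0r).
  rewrite -big_mkcond; case: leqP => jr; last first.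
    by rewrite big1 // => i /eqP ij; move: (ltn_ord i); rewrite ij ltnS leqNgt jr.
  by rewrite (big_pred1 (Ordinal (jr : (j < r.+1)%N))).
have term i j (x : R) : fps2_z1Dz2 R i j * x =
    (i == 1%N)%:R * ((j == 0%N)%:R * x) + (i == 0%N)%:R * ((j == 1%N)%:R * x).
  by rewrite /fps2_z1Dz2 mulrDl -!mulnb !natrM !mulrA.
have -> : fps2_mul (@fps2_z1Dz2 R) b p q =
    \sum_(i < p.+1) ((i == 1%N :> nat)%:R *
      \sum_(j < q.+1) (j == 0%N :> nat)%:R * b (p - i)%N (q - j)%N) +
    \sum_(i < p.+1) ((i == 0%N :> nat)%:R *
      \sum_(j < q.+1) (j == 1%N :> nat)%:R * b (p - i)%N (q - j)%N).
  rewrite -big_split; apply: eq_bigr => i _ /=.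
  by rewrite !mulr_sumr -big_split; apply: eq_bigr => j _; exact: term.
rewrite (oneD p 1%N (fun i =>
  \sum_(j < q.+1) (j == 0%N :> nat)%:R * b (p - i)%N (q - j)%N)).
rewrite (oneD p 0%N (fun i =>
  \sum_(j < q.+1) (j == 1%N :> nat)%:R * b (p - i)%N (q - j)%N)).
rewrite subn0 (oneD q 0%N (fun j => b (p - 1)%N (q - j)%N)).
rewrite (oneD q 1%N (fun j => b p (q - j)%N)).
by case: p => [|p]; case: q => [|q] //=; rewrite ?subn0 ?subSS ?subn0.
Qed.

(** The only possible quotient of [a] by [z1 + z2]: the coefficient of
    [z1^(p+1) z2^q] in [a = (z1 + z2) b] is [b_{p,q} + b_{p+1,q-1}]. *)
Fixpoint fps2_quot a p q : R :=
  if q is q'.+1 then a p.+1 q - fps2_quot a p.+1 q' else a p.+1 0%N.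

Lemma fps2_quot_uniq a b :
  (forall p q, a p q = fps2_mul (@fps2_z1Dz2 R) b p q) ->
  forall p q, b p q = fps2_quot a p q.
Proof.
move=> ab p q; elim: q p => [|q IH] p /=; rewrite ab fps2_mul_z1Dz2 ?addr0//.
by rewrite -IH addrK.
Qed.

(** Unfolding the recursion gives an alternating sum along the antidiagonal of
    degree [p + q + 1], in the form in which the hypothesis of [fps2_quotP]
    evaluates it for [p = 0]. *)
Lemma fps2_quotE a p q : fps2_quot a p q =
  (-1) ^+ q * \sum_(j < q.+1) (-1) ^+ (q - j) * a (p.+1 + j)%N (q - j)%N.
Proof.
elim: q p => [|q IH] p /=.
  by rewrite big_ord_recl big_ord0 subnn !expr0 !mul1r addr0 addn0.
rewrite IH [in RHS]big_ord_recl /= subn0 addn0 mulrDr mulrA -expr2 sqrr_sign mul1r.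
rewrite exprS mulN1r mulNr; congr (_ - _ * _).
by apply: eq_bigr => j _; rewrite subSS addSnnS.
Qed.

(** The hypothesis says that [a] vanishes at [(z1, z2) = (z, -z)], up to signs.
    The coefficients of [z1^p z2^q] with [p > 0] agree by construction of the
    quotient; it is those with [p = 0] that require it. *)
Lemma fps2_quotP a :
  (forall m, \sum_(p < m.+1) (-1) ^+ (m - p) * a p (m - p)%N = 0) ->
  forall p q, a p q = fps2_mul (@fps2_z1Dz2 R) (fps2_quot a) p q.
Proof.
move=> a0 [|p] [|q]; rewrite fps2_mul_z1Dz2 ?addr0 ?add0r //=.
- by have := a0 0%N; rewrite big_ord_recl big_ord0 subnn expr0 mul1r addr0.
- rewrite fps2_quotE; have := a0 q.+1.
  rewrite big_ord_recl /= subn0 exprS mulN1r mulNr addrC => /subr0_eq E.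
  rewrite (eq_bigr (fun j : 'I_q.+1 =>
    (-1) ^+ (q.+1 - j.+1) * a j.+1 (q.+1 - j.+1)%N)) => [|j _].
    by rewrite E mulrA -expr2 sqrr_sign mul1r.
  by rewrite add1n subSS.
- by rewrite subrK.
Qed.

End DivisionByZ1PlusZ2.

(** * Gradients and Hessians of the deformed flat functions *)

(** Scalars are handled below as one-by-one matrix products, so that symmetry
    of a contraction becomes transposition. *)
Lemma tr_mx11 (R : Type) (A : 'M[R]_1) : A 0 0 = A^T 0 0.
Proof. by rewrite mxE. Qed.

Section FrobeniusGradients.
Variables (R : realType) (n : nat) (D : set 'rV[R]_n.+1).
Variables (P1 : hydro_op R n) (u v : 'I_n.+1 -> 'rV[R]_n.+1 -> R).
Variables (eta : 'M[R]_n.+1) (F : 'rV[R]_n.+1 -> R).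
Variable theta : 'I_n.+1 -> nat -> 'rV[R]_n.+1 -> R.
Hypotheses (openD : open D) (cv : coordinates D v) (eta_unit : eta \in unitmx).
Hypothesis potF : frobenius_potential D P1 u v eta F.
Hypothesis thetaP : frobenius_thetas D P1 u v eta F theta.
Implicit Types (f g : 'rV[R]_n.+1 -> R) (w wx : 'rV[R]_n.+1).
Implicit Types (al be ga mu : 'I_n.+1).

Local Notation h := (hcal v theta).

Definition grad f w : 'rV[R]_n.+1 := \row_al dcoord v al f w.

Definition hess_row mu f w : 'rV[R]_n.+1 := \row_al dcoord v mu (dcoord v al f) w.

Definition c_matrix mu w : 'M[R]_n.+1 :=
  \matrix_(al, be) c_tensor P1 u v mu al be w.

Definition c_contract mu f g w : R :=
  (grad f w *m eta *m c_matrix mu w *m eta *m (grad g w)^T) 0 0.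

Lemma grad_pairE f g w :
  grad_pair v eta f g w = (grad f w *m eta *m (grad g w)^T) 0 0.
Proof.
rewrite -mulmxA mxE; apply: eq_bigr => xi _.
rewrite [X in _ = _ * X]mxE mulr_sumr.
by apply: eq_bigr => zeta _; rewrite !mxE mulrA.
Qed.

Lemma c_tensorC al be ga w :
  c_tensor P1 u v al be ga w = c_tensor P1 u v be al ga w.
Proof. by apply: eq_bigr => i _; congr (_ * _); rewrite mulrAC. Qed.

Lemma c_tensorCr al be ga w :
  c_tensor P1 u v al be ga w = c_tensor P1 u v al ga be w.
Proof. by apply: eq_bigr => i _; rewrite mulrAC. Qed.

Lemma c_matrix_tr mu w : (c_matrix mu w)^T = c_matrix mu w.
Proof. by apply/matrixP => al be; rewrite !mxE c_tensorCr. Qed.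

Lemma dcoord_v_low al be w : D w ->
  dcoord v be (v_low v eta al) w = eta_low eta al be.
Proof.
have [sv _ _] := cv => Dw.
rewrite (dcoord_sum v openD) //; last first.
  by move=> ga; apply: (smoothM openD) => //; exact: smooth_cst.
rewrite (bigD1 be) //= dcoordZ ?(dcoord_coord cv) ?eqxx ?mulr1 //; last first.
  exact: smooth_on_differentiable (sv be) Dw.
rewrite big1 ?addr0 // => ga /negPf gabe.
rewrite dcoordZ ?(dcoord_coord cv) 1?eq_sym ?gabe ?mulr0 //.
exact: smooth_on_differentiable (sv ga) Dw.
Qed.

(** Since [d_1 d_beta F = v_beta], the third derivatives of [F] in which [v^1]
    occurs are those of [v_beta].  Taking [d_1] as the second derivative avoids
    commuting partial derivatives. *)
Lemma c_tensor_unit al be w : D w ->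
  c_tensor P1 u v al ord0 be w = eta_low eta be al.
Proof.
have [_ Fc F1] := potF => Dw.
rewrite -Fc // -(dcoord_v_low be al Dw).
by apply: (eq_on_dcoord v openD) Dw => y Dy; exact: F1.
Qed.

(** The total symmetry of [c] is visible from its expression in canonical
    coordinates, and [eta] is the slice [c_1] of it. *)
Lemma eta_low_sym w : D w -> (eta_low eta)^T = eta_low eta.
Proof.
move=> Dw; apply/matrixP => al be; rewrite mxE -!(c_tensor_unit _ _ Dw).
by rewrite [LHS]c_tensorC [LHS]c_tensorCr [LHS]c_tensorC.
Qed.

Lemma eta_sym w : D w -> eta^T = eta.
Proof.
move=> Dw; rewrite -[eta]invmxK -/(eta_low eta) trmx_inv.
by rewrite (eta_low_sym Dw).
Qed.

Lemma smooth_theta al p : smooth_on D (theta al p).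
Proof. exact: thetaP.1. Qed.

Lemma hess_row_theta0 mu al w : D w -> hess_row mu (theta al 0%N) w = 0.
Proof.
move=> Dw; apply/rowP => be; rewrite !mxE.
rewrite -[RHS](dcoord_cst v mu (eta_low eta al be) w).
apply: (eq_on_dcoord v openD) Dw => y Dy; rewrite -(dcoord_v_low _ _ Dy).
by apply: (eq_on_dcoord v openD) Dy => z Dz; have [+ _ _ _] := thetaP.2 z Dz; apply.
Qed.

(** The deformed flatness equations in matrix form. *)
Lemma hess_row_thetaS mu al p w : D w ->
  hess_row mu (theta al p.+1) w = grad (theta al p) w *m eta^T *m c_matrix mu w.
Proof.
move=> Dw; rewrite -mulmxA -[LHS]trmxK -[RHS]trmxK; congr trmx.
rewrite !trmx_mul trmxK c_matrix_tr.
apply/colP => be; rewrite !mxE.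
have [_ _ -> _] := thetaP.2 w Dw.
under eq_bigr => xi _ do under eq_bigr => zeta _ do rewrite -mulrA.
rewrite exchange_big /=.
under [RHS]eq_bigr => zeta _ do rewrite !mxE mulr_suml.
apply: eq_bigr => zeta _; apply: eq_bigr => xi _; rewrite !mxE.
by rewrite mulrA.
Qed.

(** In [d_beta d_1 theta_{p+1} = c_{beta 1}^zeta d_zeta theta_p] the operator
    [c_1] is the identity.  This is the bridge between the calibration and the
    [theta]'s; as [h al p] stands for [h_{alpha,p-1}], the index is the same on
    both sides. *)
Lemma grad_h al p w : D w -> grad (h al p) w = grad (theta al p) w.
Proof.
move=> Dw; apply/rowP => be; rewrite !mxE /hcal.
have [_ _ -> _] := thetaP.2 w Dw; rewrite exchange_big (bigD1 be) //=.
have E zeta : \sum_xi c_tensor P1 u v be ord0 xi w * eta xi zeta = (zeta == be)%:R.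
  have -> : \sum_xi c_tensor P1 u v be ord0 xi w * eta xi zeta =
      ((eta_low eta)^T *m eta) be zeta.
    by rewrite mxE; apply: eq_bigr => xi _; rewrite c_tensor_unit // mxE.
  by rewrite (eta_low_sym Dw) /eta_low mulVmx // mxE eq_sym.
rewrite -mulr_suml E eqxx mul1r big1 ?addr0 // => zeta /negPf zb.
by rewrite -mulr_suml E zb mul0r.
Qed.

Lemma hess_row_h mu al p w : D w ->
  hess_row mu (h al p) w = hess_row mu (theta al p) w.
Proof.
move=> Dw; apply/rowP => be; rewrite [LHS]mxE [RHS]mxE.
apply: (eq_on_dcoord v openD) Dw => y Dy.
have /rowP/(_ be) := grad_h al p Dy.
by rewrite [X in X = _ -> _]mxE [X in _ = X -> _]mxE.
Qed.

Lemma c_contractC mu f g w : D w -> c_contract mu f g w = c_contract mu g f w.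
Proof.
move=> Dw; rewrite /c_contract [RHS]tr_mx11.
by rewrite !trmx_mul trmxK c_matrix_tr (eta_sym Dw) !mulmxA.
Qed.

Lemma grad_pairC f g w : D w -> grad_pair v eta f g w = grad_pair v eta g f w.
Proof.
move=> Dw; rewrite !grad_pairE [RHS]tr_mx11.
by rewrite !trmx_mul trmxK (eta_sym Dw) mulmxA.
Qed.

Lemma smooth_grad_pair f g : smooth_on D f -> smooth_on D g ->
  smooth_on D (grad_pair v eta f g).
Proof.
move=> sf sg; apply: (smooth_sum openD) => xi; apply: (smooth_sum openD) => zeta.
apply: (smoothM openD); last exact: smooth_dcoord.
by apply: (smoothM openD); [exact: smooth_dcoord|exact: smooth_cst].
Qed.

Lemma dcoord_grad_pair mu f g w : smooth_on D f -> smooth_on D g -> D w ->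
  dcoord v mu (grad_pair v eta f g) w =
  (hess_row mu f w *m eta *m (grad g w)^T) 0 0 +
  (hess_row mu g w *m eta^T *m (grad f w)^T) 0 0.
Proof.
move=> sf sg Dw.
have sdf al : smooth_on D (dcoord v al f) by exact: smooth_dcoord.
have sdg al : smooth_on D (dcoord v al g) by exact: smooth_dcoord.
have sl xi zeta : smooth_on D (fun y => dcoord v xi f y * eta xi zeta).
  by apply: (smoothM openD) => //; exact: smooth_cst.
have st xi zeta : smooth_on D
    (fun y => dcoord v xi f y * eta xi zeta * dcoord v zeta g y).
  exact: (smoothM openD).
have -> : (hess_row mu g w *m eta^T *m (grad f w)^T) 0 0 =
    (grad f w *m eta *m (hess_row mu g w)^T) 0 0.
  by rewrite [LHS]tr_mx11 !trmx_mul !trmxK mulmxA.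
rewrite (dcoord_sum v openD) //; last by move=> xi; exact: smooth_sum.
rewrite -!mulmxA mxE [X in _ = _ + X]mxE -big_split; apply: eq_bigr => xi _ /=.
rewrite (dcoord_sum v openD) // [X in _ = _ * X + _]mxE [X in _ = _ + _ * X]mxE.
rewrite !mulr_sumr -big_split; apply: eq_bigr => zeta _.
rewrite dcoordM; try exact: smooth_on_differentiable Dw.
rewrite dcoordM ?dcoord_cst;
  try exact: smooth_on_differentiable (smooth_cst openD _) Dw;
  try exact: smooth_on_differentiable Dw.
by rewrite !mxE mulr0 addr0 !mulrA.
Qed.

(** Each term of the Leibniz rule lowers one index by the deformed flatness
    equations; the coordinates [theta_{alpha,0} = v_alpha] have zero Hessian. *)
Lemma dcoord_grad_pair_theta mu al p be q w : D w ->
  dcoord v mu (grad_pair v eta (theta al p) (theta be q)) w =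
  (if p is p'.+1 then c_contract mu (theta al p') (theta be q) w else 0) +
  (if q is q'.+1 then c_contract mu (theta al p) (theta be q') w else 0).
Proof.
move=> Dw; rewrite dcoord_grad_pair //; try exact: smooth_theta.
congr (_ + _).
- case: p => [|p]; first by rewrite hess_row_theta0 // !mul0mx mxE.
  by rewrite hess_row_thetaS // (eta_sym Dw).
- case: q => [|q]; first by rewrite hess_row_theta0 // !mul0mx mxE.
  by rewrite hess_row_thetaS // (eta_sym Dw) (c_contractC _ _ _ Dw).
Qed.

(** By [grad_h] the flow of [h_{beta,q}] involves the Hessian of
    [theta_{beta,q+1}], that is [c] contracted with the gradient of
    [theta_{beta,q}]. *)
Lemma time_derivE be q f w wx : D w ->
  time_deriv v eta h be q f w wx =
  \sum_mu c_contract mu f (theta be q) w * total_x (v mu) w wx.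
Proof.
move=> Dw.
have flowE ga : principal_flow v eta h be q ga w wx =
    \sum_mu (eta *m (hess_row mu (theta be q.+1) w)^T) ga 0 * total_x (v mu) w wx.
  under [RHS]eq_bigr => mu _ do rewrite mxE mulr_suml.
  rewrite exchange_big; apply: eq_bigr => la _.
  rewrite (total_xE cv) // mulr_sumr; apply: eq_bigr => mu _.
  by rewrite mulrA -hess_row_h // [in RHS]mxE [X in _ = _ * X * _]mxE.
rewrite /time_deriv; under eq_bigr => ga _ do rewrite flowE mulr_sumr.
rewrite exchange_big; apply: eq_bigr => mu _.
rewrite hess_row_thetaS // !trmx_mul trmxK c_matrix_tr.
under eq_bigr => ga _ do rewrite mulrA.
rewrite -mulr_suml; congr (_ * _).
rewrite /c_contract -!mulmxA [RHS]mxE; apply: eq_bigr => ga _.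
by rewrite [X in _ = X * _]mxE.
Qed.

(** * The two-point functions *)

Lemma grad_pair_h al p be q w : D w ->
  grad_pair v eta (h al p) (h be q) w = grad_pair v eta (theta al p) (theta be q) w.
Proof. by move=> Dw; rewrite !grad_pairE !grad_h. Qed.

Definition h_series al be w : fps2 R := fun p q =>
  grad_pair v eta (h al p) (h be q) w - fps2_const (eta_low eta al be) p q.

Lemma generating_identity_quot :
  generating_identity D v eta h
    (fun al p be q w => fps2_quot (h_series al be w) p q).
Proof.
move=> w Dw al be p q.
(* The required vanishing is the normalization of theta(z) against theta(-z). *)
apply: (@fps2_quotP _ (h_series al be w)) => m.
have [_ _ _ /(_ al be m)] := thetaP.2 w Dw.
rewrite -[X in X = _ -> _]addr0 => E.
under eq_bigr => i _ do rewrite /h_series mulrBr grad_pair_h //.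
rewrite sumrB -[X in X - _]addr0 E; apply/eqP; rewrite subr_eq0; apply/eqP.
case: m {E} => [|m].
  by rewrite big_ord_recl big_ord0 /fps2_const /= subnn expr0 mul1r addr0.
rewrite mulr0n big1 // => i _; rewrite /fps2_const.
by case: i => -[|i] lti /=; rewrite mulr0.
Qed.

Section AnySolution.
Variable Omega : 'I_n.+1 -> nat -> 'I_n.+1 -> nat -> 'rV[R]_n.+1 -> R.
Hypothesis genO : generating_identity D v eta h Omega.

Lemma generating_identity_uniq al p be q w : D w ->
  Omega al p be q w = fps2_quot (h_series al be w) p q.
Proof.
by move=> Dw; apply: (fps2_quot_uniq (b := fun p q => Omega al p be q w)) => i j;
  exact: genO.
Qed.

Lemma Omega_rec0 al p be w : D w ->
  Omega al p be 0%N w = grad_pair v eta (theta al p.+1) (theta be 0%N) w.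
Proof.
by move=> Dw; rewrite generating_identity_uniq //= /h_series subr0 grad_pair_h.
Qed.

(** The difference is written with a factor [-1] so that the closure properties
    of sums and products apply directly. *)
Lemma Omega_recS al p be q w : D w ->
  Omega al p be q.+1 w =
  grad_pair v eta (theta al p.+1) (theta be q.+1) w + - 1 * Omega al p.+1 be q w.
Proof.
move=> Dw; rewrite !generating_identity_uniq //= mulN1r.
by rewrite [X in X - _]/h_series subr0 grad_pair_h.
Qed.

Lemma smooth_Omega al p be q : smooth_on D (Omega al p be q).
Proof.
elim: q p => [|q IH] p.
  apply: (eq_on_smooth openD) (smooth_grad_pair (smooth_theta al p.+1)
    (smooth_theta be 0)) => w Dw.
  by rewrite Omega_rec0.
apply: (eq_on_smooth openD) (smoothD openD (smooth_grad_pair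
  (smooth_theta al p.+1) (smooth_theta be q.+1))
  (smoothM openD (smooth_cst openD (-1)) (IH p.+1))) => w Dw.
by rewrite Omega_recS.
Qed.

(** Differentiating the recursion, the two terms of
    [dcoord_grad_pair_theta] are the claimed value and the one that cancels
    against the derivative of [Omega_{p+1,q}]. *)
Lemma dcoord_Omega mu al p be q w : D w ->
  dcoord v mu (Omega al p be q) w = c_contract mu (theta al p) (theta be q) w.
Proof.
elim: q p => [|q IH] p Dw.
  rewrite (eq_on_dcoord v openD mu (fun y => @Omega_rec0 al p be y) Dw).
  by rewrite dcoord_grad_pair_theta // addr0.
rewrite (eq_on_dcoord v openD mu (fun y => @Omega_recS al p be q y) Dw).
have sG := smooth_grad_pair (smooth_theta al p.+1) (smooth_theta be q.+1).
have sO := smooth_Omega al p.+1 be q.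
rewrite dcoordD; first last.
- exact: smooth_on_differentiable (smoothM openD (smooth_cst openD (-1)) sO) Dw.
- exact: smooth_on_differentiable sG Dw.
rewrite dcoordZ ?IH // ?dcoord_grad_pair_theta // ?mulN1r ?addrK //.
exact: smooth_on_differentiable sO Dw.
Qed.

Lemma total_x_Omega al p be q w wx : D w ->
  total_x (Omega al p be q) w wx =
  \sum_mu c_contract mu (theta al p) (theta be q) w * total_x (v mu) w wx.
Proof.
move=> Dw; rewrite (total_xE cv) //; apply: eq_bigr => mu _.
by rewrite dcoord_Omega.
Qed.

(** Exchanging [(alpha, z1)] with [(beta, z2)] fixes both sides of the defining
    identity; together with uniqueness this gives the symmetry of [Omega]. *)
Lemma generating_identity_swap :
  generating_identity D v eta h (fun al p be q w => Omega be q al p w).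
Proof.
move=> w Dw al be p q; have := genO Dw be al q p.
have -> : fps2_const (eta_low eta be al) q p = fps2_const (eta_low eta al be) p q.
  by rewrite /fps2_const andbC -{1}(eta_low_sym Dw) mxE.
by rewrite (grad_pairC _ _ Dw) !fps2_mul_z1Dz2 [RHS]addrC.
Qed.

End AnySolution.

(** The gradient of [theta_{1,0} = v_1] is the unit field [d/dv^1]. *)
Lemma Omega_unit Omega al p w : generating_identity D v eta h Omega -> D w ->
  Omega al p ord0 0%N w = h al p w.
Proof.
move=> genO Dw; rewrite (Omega_rec0 genO) // grad_pairE.
have -> : grad (theta ord0 0%N) w = row ord0 (eta_low eta).
  apply/rowP => be; rewrite !mxE -(dcoord_v_low _ _ Dw).
  apply: (eq_on_dcoord v openD) Dw => y Dy.
  by have [+ _ _ _] := thetaP.2 y Dy; apply.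
rewrite tr_row (eta_low_sym Dw) -mulmxA colE (mulmxA eta) mulmxV //.
by rewrite mul1mx -colE !mxE.
Qed.

Lemma tau_structure_generating Omega : generating_identity D v eta h Omega ->
  tau_structure D v eta h Omega.
Proof.
move=> genO; split.
- by move=> al p be q; exact: (smooth_Omega genO).
- move=> al p be q w wx Dw; rewrite (total_x_Omega genO _ _ _ _ _ Dw).
  rewrite (time_derivE be q (h al p) wx Dw) (time_derivE al p (h be q) wx Dw).
  split; apply: eq_bigr => mu _; first by rewrite /c_contract grad_h.
  by rewrite (c_contractC _ _ _ Dw) /c_contract grad_h.
- move=> al p be q w Dw; rewrite (generating_identity_uniq genO) //.
  by rewrite -(generating_identity_uniq (generating_identity_swap genO)).
- by move=> al p w; exact: Omega_unit.
Qed.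

End FrobeniusGradients.

Theorem proposition4p16 (R : realType) (n : nat) (D : set 'rV[R]_n.+1)
    (P1 P2 : hydro_op R n) (u v : 'I_n.+1 -> 'rV[R]_n.+1 -> R)
    (eta : 'M[R]_n.+1) (F : 'rV[R]_n.+1 -> R)
    (theta : 'I_n.+1 -> nat -> 'rV[R]_n.+1 -> R)
    (h := hcal v theta) :
  domain D ->
  irreducible_flat_exact_semisimple_bihamiltonian D P1 P2 u ->
  flat_coordinates D P1 u v eta ->
  frobenius_potential D P1 u v eta F ->
  frobenius_thetas D P1 u v eta F theta ->
  (forall w, D w -> forall al, h al 1%N w = dcoord v al F w) ->
  [/\ exists Omega, generating_identity D v eta h Omega,
      forall Omega Omega',
        generating_identity D v eta h Omega ->
        generating_identity D v eta h Omega' ->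
        forall al p be q w, D w -> Omega al p be q w = Omega' al p be q w
    & forall Omega, generating_identity D v eta h Omega ->
        tau_structure D v eta h Omega].
Proof.
move=> [openD [w0 Dw0] _] [[[_ detP1 _] _ _] _ _ _ _] [cv gramE _] potF thetaP _.
(* A Gram matrix of a nondegenerate metric; any point of the domain will do. *)
have eta_unit : eta \in unitmx.
  have [_ _ uv] := cv; rewrite -(gramE _ Dw0) !unitmx_mul unitmx_tr uv //=.
  by rewrite unitmxE unitfE detP1.
split.
- by eexists; exact: (generating_identity_quot openD cv eta_unit potF thetaP).
- move=> Omega Omega' genO genO' al p be q w Dw.
  by rewrite (generating_identity_uniq genO) // (generating_identity_uniq genO').
- exact: (tau_structure_generating openD cv eta_unit potF thetaP).
Qed.
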